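(* Let $G$ be a graph with at least one edge. Then $$\max\left\{\operatorname{res}(G),\,W(G),\,a(G)-\Gamma(\mu(G))\right\}\leq \alpha(G)\leq a(G).$$ Moreover, $$a(G)=\frac{\Delta(G)+1}{2}W(G)-\sigma_\Delta(G)\leq \frac{\Delta(G)+1}{2}\operatorname{res}(G)-\sigma_\Delta(G).$$
   Context: All graphs are finite, simple and undirected. For a graph $G$ with $m(G)\geq1$ edges, degree sequence $d_1\leq\cdots\leq d_n$ and maximum degree $\Delta=\Delta(G)$: $\alpha(G)$ is the independence number, $\mu(G)$ is the matching number, the annihilation number is $a=a(G)=\max\{k : \sum_{i=1}^k d_i\leq m(G)\}$, and the Caro–Wei sum is $W(G)=\sum_{i=1}^n\frac{1}{d_i+1}$. Put $\Gamma(0)=0$ and $\Gamma(\mu)=2\mu+1-\lceil\sqrt{6\mu}\rceil$ for integers $\mu\geq 1$. With $S_H(G)=\sum_{i=1}^{a}d_i$, define $$\sigma_\Delta(G)=\frac{\Delta(n-a)-S_H(G)}{2\Delta}+\sum_{i=1}^{a}\frac{(\Delta-d_i)(\Delta-d_i-1)}{2\Delta(d_i+1)}+\sum_{i=a+1}^{n}\frac{\Delta-d_i}{2(d_i+1)} .$$ The Havel–Hakimi residue $\operatorname{res}(G)$: starting from the degree sequence in non-increasing order, repeatedly delete the first (largest) term $d$, subtract $1$ from each of the next $d$ terms, and re-sort in non-increasing order, until all remaining terms are $0$; $\operatorname{res}(G)$ is the number of zeros remaining. *)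

(* Defs.v *)
From HB Require Import structures.
From mathcomp Require Import all_boot all_order all_algebra.
From mathcomp Require Import reals.
Set Implicit Arguments.
Unset Strict Implicit.
Unset Printing Implicit Defensive.
Import Order.TTheory GRing.Theory Num.Theory.
Local Open Scope ring_scope.

(* A finite simple graph is a finType [T] of vertices with a symmetric and
   irreflexive adjacency relation [e]; the two properties are hypotheses of
   the theorem. *)

Section Graph.
Variables (T : finType) (e : rel T).

Definition edges : {set {set T}} := [set [set p.1; p.2] | p : T * T & e p.1 p.2].

Definition num_edges : nat := #|edges|.

Definition degree (x : T) : nat := #|[set y | e x y]|.

Definition max_degree : nat := (\max_(x : T) degree x)%N.

Definition independent (S : {set T}) : bool :=
  [forall x in S, forall y in S, ~~ e x y].

Definition independence_number : nat :=
  (\max_(S : {set T} | independent S) #|S|)%N.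

Definition matching (M : {set {set T}}) : bool :=
  (M \subset edges) && trivIset M.

Definition matching_number : nat :=
  (\max_(M : {set {set T}} | matching M) #|M|)%N.

(* Non-decreasing and 0-indexed: [d_i], for 1 <= i <= n, is
   [nth 0 degree_seq i.-1]. *)
Definition degree_seq : seq nat := sort leq [seq degree x | x <- enum T].

Definition annihilation_number : nat :=
  (\max_(k < #|T|.+1 | (\sum_(i < k) nth 0 degree_seq i <= num_edges)%N) k)%N.

End Graph.

(* [s] is meant to be non-increasing. On the degree sequences of graphs and
   the sequences obtained from them, the [d] terms following the head [d]
   exist and are positive, so neither [take] nor [predn] truncates. *)
Definition havel_hakimi_step (s : seq nat) : seq nat :=
  if s is d :: s' then sort geq ([seq x.-1 | x <- take d s'] ++ drop d s')
  else [::].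

(* Each step shortens the sequence by one, so with fuel at least [size s] the
   fuel never runs out before all remaining terms are 0. *)
Fixpoint havel_hakimi_zeros (fuel : nat) (s : seq nat) : nat :=
  if all (pred1 0%N) s then size s
  else if fuel is fuel'.+1
       then havel_hakimi_zeros fuel' (havel_hakimi_step s)
       else 0%N.

Definition residue (T : finType) (e : rel T) : nat :=
  havel_hakimi_zeros #|T| (sort geq [seq degree e x | x <- enum T]).

Section RealParameters.
Variable R : realType.

Definition Gamma (mu : nat) : int :=
  if mu == 0%N then 0
  else 2 * mu%:Z + 1 - Num.ceil (Num.sqrt (6 * mu%:R : R)).

Variables (T : finType) (e : rel T).

Local Notation n := #|T|.
Local Notation a := (annihilation_number e).
Local Notation Delta := ((max_degree e)%:R : R).
Local Notation d i := ((nth 0%N (degree_seq e) i)%:R : R).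

Definition caro_wei : R := \sum_(0 <= i < n) 1 / (d i + 1).

Definition S_H : R := \sum_(0 <= i < a) d i.

Definition sigma : R :=
  (Delta * (n%:R - a%:R) - S_H) / (2 * Delta)
  + \sum_(0 <= i < a)
      (Delta - d i) * (Delta - d i - 1) / (2 * Delta * (d i + 1))
  + \sum_(a <= i < n) (Delta - d i) / (2 * (d i + 1)).

End RealParameters.

(* Main.v *)
(* Bounds on the residue compare degree sequences through excess s t = sum of
   (x - t)^+ over the terms x of s: for sequences with the same sum, pointwise
   comparison of excesses is majorization.  One Havel-Hakimi step on a :: s
   turns the excess V of s into max (V t - a, V (t+1)).  The residue is
   monotone for majorization.  If the heads agree, this is immediate by
   induction; otherwise move one unit from the second to the first term of the
   smaller sequence, after which one step yields two sequences differing by one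
   unit in two places, and this relation persists under further steps until it
   becomes majorization.  Since the degree sequence of G - v, for v of maximum
   degree, majorizes the Havel-Hakimi step of the degree sequence of G, induction
   gives res <= alpha.  Each step does not decrease the Caro-Wei sum, whence
   W <= res.

   For a - Gamma <= alpha, let K be the k = n - a vertices of largest degree.
   Their degrees sum to at least m, so G - K has at most as many edges as G[K].
   On G - K use 2 alpha + mu + m >= 2 n; on G[K], a maximal matching leaves an
   independent set of u vertices, so G[K] has at most C(k,2) - C(u,2) edges.
   With s = alpha + 2 mu - n this gives 6 mu <= (s + k + 1)^2. *)
Require Import Defs.
From HB Require Import structures.
From mathcomp Require Import all_boot all_order all_algebra.
From mathcomp Require Import reals zify.
Set Implicit Arguments.
Unset Strict Implicit.
Unset Printing Implicit Defensive.
Import Order.TTheory GRing.Theory Num.Theory.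

(** * Excess and Havel-Hakimi steps *)

Lemma geq_trans : transitive geq.
Proof. exact: rev_trans leq_trans. Qed.

Lemma geq_total : total geq.
Proof. by move=> m n; rewrite /= orbC leq_total. Qed.

Definition excess (s : seq nat) (t : nat) : nat := \sum_(x <- s) (x - t).

Lemma excess_cons x s t : excess (x :: s) t = x - t + excess s t.
Proof. by rewrite /excess big_cons. Qed.

Lemma perm_excess s1 s2 t : perm_eq s1 s2 -> excess s1 t = excess s2 t.
Proof. by move=> eq12; rewrite /excess (perm_big _ eq12). Qed.

(** Turns counts of large terms into differences of excesses, so that the condition that enough
    positive terms follow a head becomes linear arithmetic. *)
Lemma excessS s t : excess s t = excess s t.+1 + count (ltn t) s.
Proof.
elim: s => [|x s IHs]; first by rewrite /excess !big_nil.
by rewrite !excess_cons /= IHs; case: (ltnP t x) => /=; lia.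
Qed.

Lemma count_gtn_anti s t u : t <= u -> count (ltn u) s <= count (ltn t) s.
Proof. by move=> le_tu; apply: sub_count => x /=; apply: leq_ltn_trans. Qed.

Lemma excess_anti s t u : t <= u -> excess s u <= excess s t.
Proof. by move=> le_tu; apply: leq_sum => x _; apply: leq_sub2l. Qed.

Lemma excess_head s t : head 0 s - t <= excess s t.
Proof. by case: s => [|x s]; rewrite ?excess_cons ?leq_addr. Qed.

Lemma sorted_geq_le x s : sorted geq (x :: s) -> {in s, forall y, y <= x}.
Proof.
by move=> /(order_path_min geq_trans) /allP hs y /hs.
Qed.

Lemma excess_eq0 s t : sorted geq s -> (excess s t == 0) = (head 0 s <= t).
Proof.
case: s => [|x s] s_sorted; first by rewrite /excess big_nil.
apply/idP/idP => [/eqP|/= le_xt]; first by rewrite excess_cons /=; lia.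
apply/eqP; rewrite /excess big1_seq // => y /andP[_].
rewrite inE => /predU1P[->|/(sorted_geq_le s_sorted)]; lia.
Qed.

(** The step before re-sorting: [excess] ignores the order, so its value can be found here by plain
    induction. *)
Definition lay_off (k : nat) (s : seq nat) : seq nat :=
  [seq x.-1 | x <- take k s] ++ drop k s.

(** Lowering the [k] largest terms costs one unit of excess at [t] for each lowered term above [t]:
    [k] units if at least [k] terms exceed [t], and otherwise one for each such term, which leaves
    [excess s t.+1]. *)
Lemma excess_lay_off k s t : sorted geq s ->
  excess (lay_off k s) t = maxn (excess s t - k) (excess s t.+1).
Proof.
have excess0 u : excess [::] u = 0 by rewrite /excess big_nil.
rewrite /lay_off; elim: s k => [|x s IHs] [|k] s_sorted /=.
- by rewrite !excess0.
- by rewrite !excess0.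
- by rewrite subn0; apply/esym/maxn_idPl/excess_anti.
rewrite excess_cons IHs ?(path_sorted s_sorted) // !excess_cons.
have [le_xt|] := leqP x t; last lia.
have /eqP-> : excess s t == 0.
  rewrite excess_eq0 ?(path_sorted s_sorted) //.
  case: s s_sorted {IHs} => //= y s /andP[le_yx _]; exact: leq_trans le_xt.
have := leqnSn t; lia.
Qed.

Arguments havel_hakimi_step : simpl never.

Lemma step_cons a s : havel_hakimi_step (a :: s) = sort geq (lay_off a s).
Proof. by []. Qed.

Lemma sorted_step s : sorted geq (havel_hakimi_step s).
Proof.
by case: s => // a s; exact: sort_sorted geq_total _.
Qed.

Lemma size_step s : size (havel_hakimi_step s) = (size s).-1.
Proof.
case: s => // a s; rewrite step_cons size_sort size_cat size_map.
by rewrite -size_cat cat_take_drop.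
Qed.

Lemma excess_step a s t : sorted geq (a :: s) ->
  excess (havel_hakimi_step (a :: s)) t =
    maxn (excess s t - a) (excess s t.+1).
Proof.
move=> s_sorted; rewrite -excess_lay_off ?(path_sorted s_sorted) //.
by apply: perm_excess; rewrite step_cons perm_sort.
Qed.

Lemma all0_head s : sorted geq s -> all (pred1 0) s = (head 0 s == 0).
Proof.
case: s => // x s s_sorted /=; case: eqP => //= x0.
by apply/allP => y /(sorted_geq_le s_sorted); rewrite x0 leqn0.
Qed.

(** For sorted [s] of length [n] this is the Havel-Hakimi test for graphic sequences. It guarantees
    that each step lowers the sum by exactly twice the head. *)
Fixpoint laying_off_ok (n : nat) (s : seq nat) : bool :=
  if n is n'.+1 then
    (head 0 s == 0) ||
    (head 0 s <= count (ltn 0) (behead s)) &&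
      laying_off_ok n' (havel_hakimi_step s)
  else true.

Lemma havel_hakimi_zeros_le_size n s : havel_hakimi_zeros n s <= size s.
Proof.
elim: n s => [|n IHn] s /=; case: ifP => // _.
by apply: leq_trans (IHn _) _; rewrite size_step leq_pred.
Qed.

(** * Majorization, near-majorization and the effect of one step *)

Definition majorizes (d e : seq nat) : Prop :=
  excess d 0 = excess e 0 /\ forall t, excess e t <= excess d t.

(* [d] arises from [e] by removing one unit from a largest term [b] and one from
   another term, equal to [c]: the last clause says that [c] occurs in [e]
   besides that [b].  The clause before it provides enough terms [>= c - 1] to
   absorb the subtractions of a step. *)
Definition near_majorizes (b c : nat) (d e : seq nat) : Prop :=
  [/\ 0 < c <= b, b = head 0 e,
      forall t, excess e t = excess d t + (t < b) + (t < c),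
      forall t, t.+1 < c -> excess e t.+1 + b < excess e t
    & (excess e c).*2 + (c == b) < excess e c.-1 + excess e c.+1].

Lemma excess_ge_head s t : sorted geq s -> head 0 s <= t -> excess s t = 0.
Proof. by move=> s_sorted le_st; apply/eqP; rewrite excess_eq0. Qed.

Lemma excess_tail_ge x s t : sorted geq (x :: s) -> x <= t -> excess s t = 0.
Proof.
move=> s_sorted le_xt; have := excess_ge_head s_sorted le_xt.
by rewrite excess_cons => /eqP; rewrite addn_eq0 => /andP[_ /eqP].
Qed.

(** The head of a sorted sequence is the least zero of its excess; this is how heads are read off
    from excess formulas. *)
Lemma head_eq s b : sorted geq s ->
  excess s b = 0 -> (b = 0 \/ 0 < excess s b.-1) -> b = head 0 s.
Proof.
move=> s_sorted /eqP; rewrite excess_eq0 // => le_hb [b0|]; first lia.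
by rewrite lt0n excess_eq0 //; lia.
Qed.

Lemma near_majorizes_head b c d e : sorted geq d -> sorted geq e ->
  near_majorizes b c d e -> head 0 d = b \/ head 0 d = b.-1.
Proof.
move=> d_sorted e_sorted [/andP[c_gt0 le_cb] b_head Ed _ Hc].
have d0 : head 0 d <= b.
  by rewrite -excess_eq0 // -leqn0; have := Ed b; rewrite excess_ge_head //; lia.
suff : b.-1 <= head 0 d by lia.
case: e b_head e_sorted Ed Hc => /= [|b1 r] b_head e_sorted Ed Hc; first lia.
subst b1; case: b => [|[|b]] // in le_cb d0 e_sorted Ed Hc *.
(* Here [b] stands for the head of [e] minus two. If [d] had no excess there, the head would be the
   only term of [e] above [b], while [c] would exceed [b] too, against the last clause. *)
rewrite ltnNge -excess_eq0 //; apply/eqP => db0.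
have := Ed b; rewrite db0 excess_cons.
have V2 := excess_tail_ge e_sorted (leqnn _).
have [le_cb'|gt_cb'] := leqP c b; first lia.
move: Hc; rewrite !excess_cons => Hc.
have := @excess_anti r b c.-1; have := @excess_anti r c c.+1; lia.
Qed.

(** The unit at [b] disappears with the heads. One extra unit remains in [r], at level [c], and the
    step of [b :: r] subtracts one unit more, so the sums agree again. Where the extra unit could
    still show, enough terms exceed [t] to absorb all [b] subtractions. *)
Lemma near_step_lt b c q r :
  sorted geq (b.-1 :: q) -> sorted geq (b :: r) ->
  near_majorizes b c (b.-1 :: q) (b :: r) -> b.-1 <= count (ltn 0) q ->
  b <= count (ltn 0) r /\
  majorizes (havel_hakimi_step (b.-1 :: q)) (havel_hakimi_step (b :: r)).
Proof.
move=> d_sorted e_sorted [/andP[c_gt0 le_cb] _ Ed Cc _] q_pos.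
have W t : excess r t = excess q t + (t < c).
  have := Ed t; rewrite !excess_cons; lia.
have V0 := excessS r 0; have W0 := excessS q 0.
have C t : t.+1 < c -> excess r t.+1 + b <= excess r t.
  by move=> lt_tc; have := Cc t lt_tc; rewrite !excess_cons; lia.
have r_pos : b <= count (ltn 0) r.
  have [/C|] := ltnP 1 c; first lia.
  by have := W 0; have := W 1; lia.
split=> //; split=> [|t]; rewrite !excess_step //.
  by have := W 0; have := W 1; lia.
by have := W t; have := W t.+1; have := C t; lia.
Qed.

(** Both steps subtract the same amount, so a difference of two units survives; the case analysis
    finds their new levels [b'] and [c']. *)
Lemma near_step_eq b c q r :
  sorted geq (b :: q) -> sorted geq (b :: r) ->
  near_majorizes b c (b :: q) (b :: r) -> b <= count (ltn 0) q ->
  b <= count (ltn 0) r /\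
  exists b' c', near_majorizes b' c'
    (havel_hakimi_step (b :: q)) (havel_hakimi_step (b :: r)).
Proof.
move=> d_sorted e_sorted [/andP[c_gt0 le_cb] _ Ed Cc Hc] q_pos.
(* From here [b] and [c] denote the old values minus one. *)
case: c c_gt0 le_cb Ed Cc Hc => // c _; case: b d_sorted e_sorted q_pos => // b.
rewrite ltnS => d_sorted e_sorted q_pos le_cb Ed Cc; rewrite [c.+1.-1]/= => Hc.
pose Q := excess q; pose V := excess r; pose N t := count (ltn t) r.
have W t : V t = Q t + (t <= b) + (t <= c).
  by have := Ed t; rewrite !excess_cons /V /Q; lia.
have VS t : V t = V t.+1 + N t by exact: excessS.
have Vb t : b < t -> V t = 0 by exact: excess_tail_ge.
have Nanti t u : t <= u -> N u <= N t by exact: count_gtn_anti.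
have C t : t < c -> b < N t.
  by move=> lt_tc; have := Cc t lt_tc; rewrite !excess_cons -!/(V _);
    have := VS t; lia.
(* The last clause of [near_majorizes], read on the tail: some term of [r] equals the old [c]. *)
have H : N c.+1 < N c.
  by move: Hc; rewrite !excess_cons -!/(V _); have := VS c; have := VS c.+1; lia.
have W0 : b < Q 0 - Q 1 by rewrite /Q excessS; lia.
have r_pos : b < N 0.
  have [/C|] := ltnP 0 c; first lia.
  by have := W 0; have := W 1; have := VS 0; lia.
split=> //.
set d' := havel_hakimi_step (b.+1 :: q).
set e' := havel_hakimi_step (b.+1 :: r).
have Ue t : excess e' t = maxn (V t - b.+1) (V t.+1) by exact: excess_step.
have Ud t : excess d' t = maxn (Q t - b.+1) (Q t.+1).
  exact: excess_step.
have e'_sorted : sorted geq e' by exact: sorted_step.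
clearbody Q V N d' e'; clear Ed Cc Hc d_sorted e_sorted q_pos.
have VNb : V b = N b by rewrite VS Vb.
have Nb_gt0 : (c == b) < N b by have := W b; lia.
(* Each of the two levels falls by one, unless more terms reach it than the step lowers. The last
   summand is for [c = b], where the second unit keeps its level only if there is room for both. *)
have near t : excess e' t = excess d' t +
    ((t < b) + (t < c) + [&& t == c, c < b & b.+1 < N t]
     + ((t == b) && (b.+1 < N b)) + [&& t == b, c == b & b.+2 < N b]).
  rewrite Ue Ud.
  have [lt_bt|] := ltnP b t.
    by have := Vb t; have := Vb t.+1; have := W t; have := W t.+1; lia.
  rewrite leq_eqVlt => /predU1P[->|lt_tb].
    by have := W b; have := W b.+1; have := Vb b.+1; lia.
  have := W t; have := W t.+1; have := VS t; have := C t; lia.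
have [le_Nbb|lt_bNb] := leqP (N b) b.+1.
  case: b => [|b] in le_cb W W0 Vb C r_pos Ue Ud VNb Nb_gt0 near le_Nbb *.
    by have := W 0; have := W 1; have := VS 0; lia.
  have head_e : b.+1 = head 0 e'.
    apply: head_eq => //; rewrite !Ue /=; last by right; lia.
    by have := Vb b.+2; lia.
  have VSb := VS b.
  have [eq_cb|ne_cb] := eqVneq c b.+1.
    exists b.+1, b.+1; split=> //.
    - lia.
    - by move=> t; rewrite near; lia.
    - move=> t lt_tb; rewrite !Ue; have := VS t; have := VS t.+1; have := VS t.+2.
      by have := C t; have := C t.+1; lia.
    - rewrite !Ue /=; have := C b; have := Vb b.+2; have := Vb b.+3; lia.
  have [lt_bN|le_Nb] := ltnP b.+2 (N c).
    exists b.+1, c.+1; split=> //.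
    - lia.
    - by move=> t; rewrite near; case: eqP => [->|]; lia.
    - move=> t lt_tb; rewrite !Ue; have := VS t; have := VS t.+1.
      have := C t; have := C t.+1; have := Nanti t c; have := Nanti t.+1 c; lia.
    - rewrite !Ue /=; have := VS c; have := VS c.+1; have := VS c.+2.
      have := Nanti c.+1 c.+2; have := Vb c.+2; have := Vb c.+1; have := Vb c.+3.
      have [eqc|] := eqVneq c b; first by subst c; lia.
      lia.
  case: c => [|c] in le_cb W C H Nb_gt0 near ne_cb le_Nb *.
    by have := W 0; have := W 1; have := VS 0; lia.
  exists b.+1, c.+1; split=> //.
  - by move=> t; rewrite near; case: eqP => [->|]; lia.
  - move=> t lt_tb; rewrite !Ue; have := VS t; have := VS t.+1.
    by have := C t; have := C t.+1; lia.
  - rewrite !Ue /=; have := VS c; have := VS c.+1; have := VS c.+2.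
    by have := C c; lia.
have Nge t : t <= b -> b.+1 < N t.
  by move=> /Nanti; exact: leq_trans.
have head_e : b.+1 = head 0 e'.
  apply: head_eq => //; rewrite !Ue /=; last by right; lia.
  by have := Vb b.+1; have := Vb b.+2; lia.
have Cgen t : t < b -> excess e' t.+1 + b.+1 < excess e' t.
  move=> lt_tb; rewrite !Ue; have := Nge t; have := Nge t.+1.
  by have := VS t; have := VS t.+1; lia.
have [eq_cb|ne_cb] := eqVneq c b.
  subst c; have [lt_b|le_b] := ltnP b.+2 (N b).
    exists b.+1, b.+1; split=> //.
    - by move=> t; rewrite near; lia.
    - by rewrite !Ue /=; have := Vb b.+1; have := Vb b.+2; have := Vb b.+3; lia.
  case: b => [|b] in le_cb W W0 Vb C r_pos Ue Ud VNb Nb_gt0 near lt_bNb Nge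
    head_e Cgen le_b H *.
    by have := W 0; have := W 1; have := VS 0; lia.
  exists b.+2, b.+1; split=> //.
  - lia.
  - by move=> t; rewrite near; lia.
  - by move=> t lt_tb; apply: Cgen; lia.
  - rewrite !Ue /=; have := Vb b.+2; have := Vb b.+3.
    by have := Nge b; have := VS b; lia.
exists b.+1, c.+1; split=> //.
- by move=> t; rewrite near; case: eqP => [->|]; have := Nge c; lia.
- by move=> t lt_tc; apply: Cgen; lia.
- rewrite !Ue /=; have := VS c; have := VS c.+1; have := VS c.+2.
  have := Nge c; have := Nge c.+1; have := Vb c.+2; have := Vb c.+3; lia.
Qed.

(** Here [q] is [r] with a largest term lowered by one, that unit having gone to the head. The step
    then takes one unit more from [q] than from [r], so the results differ by two units: the
    transferred one and the extra subtraction. *)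
Lemma transfer_step a b q r : b < a ->
  sorted geq (a.+1 :: q) -> sorted geq (a :: r) -> head 0 r = b.+1 ->
  (forall t, excess r t = excess q t + (t <= b)) -> a < count (ltn 0) q ->
  a <= count (ltn 0) r /\
  exists b' c', near_majorizes b' c'
    (havel_hakimi_step (a.+1 :: q)) (havel_hakimi_step (a :: r)).
Proof.
move=> lt_ba d_sorted e_sorted r_head.
pose Q := excess q; pose V := excess r; pose N t := count (ltn t) r.
move=> W q_pos; rewrite -/(N 0) in W *.
have {}W t : V t = Q t + (t <= b) by exact: W.
have VS t : V t = V t.+1 + N t by exact: excessS.
have r_sorted : sorted geq r by exact: path_sorted e_sorted.
have Vb t : b < t -> V t = 0.
  by move=> lt_bt; rewrite /V excess_ge_head // r_head.
have Vge t : b.+1 - t <= V t by rewrite -r_head; exact: excess_head.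
have Nanti t u : t <= u -> N u <= N t by exact: count_gtn_anti.
have {q_pos} W0 : a < Q 0 - Q 1 by rewrite /Q excessS; lia.
have N0_ge : a <= N 0 by have := W 0; have := W 1; have := VS 0; lia.
split=> //.
set d' := havel_hakimi_step (a.+1 :: q).
set e' := havel_hakimi_step (a :: r).
have Ue t : excess e' t = maxn (V t - a) (V t.+1) by exact: excess_step.
have Ud t : excess d' t = maxn (Q t - a.+1) (Q t.+1) by exact: excess_step.
have e'_sorted : sorted geq e' by exact: sorted_step.
clearbody Q V N d' e'; clear d_sorted e_sorted r_sorted r_head.
have VNb : V b = N b by rewrite VS Vb.
have Nb_gt0 : 0 < N b by have := W b; lia.
have near t : excess e' t = excess d' t +
    ((t < b) + ((t <= b) && (a < N t)) + ((t == b) && (a.+1 < N b))).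
  rewrite Ue Ud.
  have [lt_bt|] := ltnP b t.
    by have := Vb t; have := Vb t.+1; have := W t; have := W t.+1; lia.
  rewrite leq_eqVlt => /predU1P[->|lt_tb].
    by have := W b; have := W b.+1; have := Vb b.+1; lia.
  by have := W t; have := W t.+1; have := VS t; lia.
have [le_Nba|lt_aNb] := leqP (N b) a.
  (* This [c] is the term number [a + 1] of [r] in decreasing order, the one that only the longer
     subtraction reaches. *)
  have [|c le_Nca c_min] := @ex_minnP (fun t => N t <= a); first by exists b.
  have le_cb : c <= b by exact: c_min.
  case: c => [|c] in le_Nca c_min le_cb *.
    by have := W 0; have := W 1; have := VS 0; have := Vb 1; lia.
  have lt_aNc : a < N c by rewrite ltnNge; apply/negP => /c_min; rewrite ltnn.
  have Nge t : t <= c -> a < N t by move=> /Nanti; exact: leq_trans.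
  exists b, c.+1; split.
  - by [].
  - apply: head_eq => //; rewrite !Ue; first by have := Vb b.+1; lia.
    move: VNb Nb_gt0 le_Nba; clear; case: b => [|b] * /=; [by left | right; lia].
  - move=> t; rewrite near.
    have := Nge t; have := @Nanti c.+1 t; lia.
  - move=> t lt_tc; rewrite !Ue; have := VS t; have := VS t.+1.
    by have := Nge t; have := Nge t.+1; lia.
  - rewrite !Ue /=; have := VS c; have := VS c.+1; have := VS c.+2.
    have := Nanti c.+1 c.+2; have := Vb c.+2; have := Vb c.+3.
    have := Vge c.+1; have [eqc|] := eqVneq c.+1 b.
      by rewrite -eqc in Nb_gt0 *; lia.
    lia.
have Nge t : t <= b -> a < N t by move=> /Nanti; exact: leq_trans.
have head_e : b.+1 = head 0 e'.
  apply: head_eq => //; rewrite !Ue /=; last by right; lia.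
  by have := Vb b.+1; have := Vb b.+2; lia.
have C t : t < b -> excess e' t.+1 + b.+1 < excess e' t.
  move=> lt_tb; rewrite !Ue; have := Nge t; have := Nge t.+1.
  by have := VS t; have := VS t.+1; lia.
have [lt_Nb|le_Nb] := ltnP a.+1 (N b).
  exists b.+1, b.+1; split=> //; first by rewrite leqnn.
  - by move=> t; rewrite near; have := Nge t; lia.
  - by rewrite !Ue /=; have := Vb b.+1; have := Vb b.+2; have := Vb b.+3; lia.
case: b => [|b] in lt_ba W Vb Vge VNb Nb_gt0 near Nge head_e C lt_aNb le_Nb *.
  by have := W 0; have := W 1; have := VS 0; lia.
exists b.+2, b.+1; split=> //; first by rewrite /= leqnSn.
- by move=> t; rewrite near; have := Nge t; lia.
- by move=> t lt_tb; apply: C; lia.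
- rewrite !Ue /=; have := Vb b.+2; have := Vb b.+3.
  by have := Nge b; have := VS b; lia.
Qed.

(** * Monotonicity of the residue *)

Definition residue_le (n : nat) (e d : seq nat) : Prop :=
  laying_off_ok n d ->
  laying_off_ok n e /\ havel_hakimi_zeros n e <= havel_hakimi_zeros n d.

Lemma residue_le_trans n s1 s2 s3 :
  residue_le n s1 s2 -> residue_le n s2 s3 -> residue_le n s1 s3.
Proof.
move=> le12 le23 /le23[/le12[-> le_z12]]; split=> //.
exact: leq_trans le_z12 _.
Qed.

Lemma havel_hakimi_zeros0 n s :
  sorted geq s -> head 0 s = 0 -> havel_hakimi_zeros n s = size s.
Proof. by case: n => [|n] s_sorted s0 /=; rewrite all0_head ?s0. Qed.

Lemma laying_off_ok0 n s : head 0 s = 0 -> laying_off_ok n s.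
Proof. by case: n => //= n ->. Qed.

Lemma laying_off_ok_step n x q : sorted geq (x :: q) ->
  laying_off_ok n.+1 (x :: q) ->
  x <= count (ltn 0) q /\ laying_off_ok n (havel_hakimi_step (x :: q)).
Proof.
move=> d_sorted /= /orP[/eqP x0|/andP[-> ->] //]; subst x; split=> //.
apply/laying_off_ok0/eqP; rewrite -leqn0 -excess_eq0 ?sorted_step //.
by rewrite excess_step // !(excess_tail_ge d_sorted).
Qed.

(** Reduces a comparison to the sequences after one step. It also settles [x = 0], where the larger
    residue is the full length. *)
Lemma residue_le_step n x y q r : sorted geq (x :: q) -> 0 < y ->
  size r <= size q ->
  (x <= count (ltn 0) q -> y <= count (ltn 0) r /\
   residue_le n (havel_hakimi_step (y :: r)) (havel_hakimi_step (x :: q))) ->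
  residue_le n.+1 (y :: r) (x :: q).
Proof.
move=> d_sorted y_gt0 le_size IH ok_d.
have [/IH[y_le le_res] /le_res[ok_e le_z]] := laying_off_ok_step d_sorted ok_d.
have [x0|x_neq0] := eqVneq x 0.
  split; first by rewrite /= y_le ok_e orbT.
  rewrite (havel_hakimi_zeros0 _ d_sorted) //.
  exact: leq_trans (havel_hakimi_zeros_le_size _ _) _.
by rewrite /= (gtn_eqF y_gt0) (negPf x_neq0) /= y_le.
Qed.

Lemma majorizes_head d e : sorted geq d -> sorted geq e ->
  majorizes d e -> head 0 e <= head 0 d.
Proof.
move=> d_sorted e_sorted [_ le_ed]; rewrite -excess_eq0 // -leqn0.
by rewrite (leq_trans (le_ed _)) // leqn0 excess_eq0.
Qed.

Lemma majorizes_step y q r : sorted geq (y :: q) -> sorted geq (y :: r) ->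
  majorizes (y :: q) (y :: r) -> y <= count (ltn 0) q ->
  y <= count (ltn 0) r /\
  majorizes (havel_hakimi_step (y :: q)) (havel_hakimi_step (y :: r)).
Proof.
move=> d_sorted e_sorted [E0 le_ed] q_pos.
have le_rq t : excess r t <= excess q t.
  by have := le_ed t; rewrite !excess_cons leq_add2l.
have := E0; rewrite !excess_cons => /addnI {}E0.
have := excessS q 0; have := excessS r 0; have := le_rq 1 => le1 Er Eq.
split; first lia.
split=> [|t]; rewrite !excess_step //; first lia.
by have := le_rq t; have := le_rq t.+1; lia.
Qed.

Lemma residue_le_majorizes_near n :
  (forall d e, sorted geq d -> sorted geq e -> size d = n -> size e = n ->
     majorizes d e -> residue_le n e d) /\
  (forall b c d e, sorted geq d -> sorted geq e -> size d = n -> size e = n ->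
     near_majorizes b c d e -> residue_le n e d).
Proof.
elim: n => [|n [IHmaj IHnear]].
  split=> [d e _ _|b c d e _ _] /size0nil-> /size0nil-> //.
split=> [d e|b c d e d_sorted e_sorted].
  case: e => // y r; case: d => // x q.
  (* Inner induction on the gap between the heads: a transfer raises the smaller head by one without
     changing the length. *)
  have [m le_m] := ubnP (x - y); elim: m => // m IHm in y r le_m *.
  move=> d_sorted e_sorted [sz_q] [sz_r] maj.
  have /= le_yx := majorizes_head d_sorted e_sorted maj.
  have [y0|y_gt0] := posnP y.
    split; first exact: laying_off_ok0.
    have x0 : x = 0.
      by case: maj; rewrite (excess_ge_head e_sorted) ?y0 // excess_cons; lia.
    by rewrite !havel_hakimi_zeros0 //= sz_q sz_r.
  have [eq_xy|ne_xy] := eqVneq x y.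
    subst y; apply: residue_le_step; rewrite ?sz_q ?sz_r // => q_pos.
    have [-> maj'] := majorizes_step d_sorted e_sorted maj q_pos; split=> //.
    by apply: IHmaj; rewrite ?sorted_step ?size_step.
  (* As [y < x] and the sums agree, the smaller sequence must have a positive second term. *)
  case: r => [|b r'] in e_sorted sz_r maj *.
    have q0 : q = [::] by apply: size0nil; rewrite sz_q -sz_r.
    by exfalso; case: maj; rewrite q0 /excess !big_seq1; lia.
  case: b => [|b] in e_sorted sz_r maj *.
    case: maj => + _; have := excess_tail_ge (path_sorted e_sorted) (leqnn _).
    by rewrite !excess_cons => *; exfalso; lia.
  pose s := sort geq (b :: r').
  have s_sorted : sorted geq (y.+1 :: s).
    rewrite /= path_sortedE; last exact: geq_trans.
    rewrite (sort_sorted geq_total) andbT.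
    rewrite all_sort /=; apply/andP; split.
      by have := sorted_geq_le e_sorted (mem_head _ _) => /=; lia.
    apply/allP => z z_r'; have := sorted_geq_le e_sorted.
    by move=> /(_ z); rewrite inE z_r' orbT => /(_ isT) /=; lia.
  have sE t : excess (b.+1 :: r') t = excess s t + (t <= b).
    have /(perm_excess t) -> : perm_eq s (b :: r') by rewrite perm_sort.
    by rewrite !excess_cons; lia.
  have lt_by : b < y by case/andP: e_sorted.
  have sz_s : size s = n by rewrite size_sort.
  apply: (@residue_le_trans _ _ (y.+1 :: s)).
    apply: residue_le_step; rewrite ?sz_s ?sz_r // => s_pos.
    have [-> [b' [c' near']]] :=
      transfer_step lt_by s_sorted e_sorted erefl sE s_pos.
    by split=> //; apply: IHnear near'; rewrite ?sorted_step ?size_step /= ?sz_s.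
  (* The transfer raises the excess only for [b < t <= y]; there the raised head is the only term
     that counts, and [x] alone dominates it. *)
  apply: IHm => //=; rewrite ?sz_s ?sz_q //; first lia.
  case: maj => E0 le_ed; split=> [|t].
    by have := sE 0; rewrite E0 !excess_cons; lia.
  have := le_ed t; have := sE t; have := excess_head (x :: q) t.
  rewrite /= !excess_cons.
  have := @excess_tail_ge _ _ t (path_sorted e_sorted); lia.
case: e => // y r in e_sorted *; case: d => // x q in d_sorted *.
move=> [sz_q] [sz_r] near; have [/andP[c_gt0 le_cb] /= by_ _ _ _] := near.
have y_gt0 : 0 < y by lia.
subst y; apply: residue_le_step; rewrite ?sz_q ?sz_r // => q_pos.
have [/= xb|/= xb] := near_majorizes_head d_sorted e_sorted near; subst x.
  have [-> [b' [c' near']]] := near_step_eq d_sorted e_sorted near q_pos.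
  by split=> //; apply: IHnear near'; rewrite ?sorted_step ?size_step.
have [-> maj'] := near_step_lt d_sorted e_sorted near q_pos.
by split=> //; apply: IHmaj; rewrite ?sorted_step ?size_step.
Qed.

(** * Residue and independent sets *)

Section InducedDegrees.
Variables (T : finType) (e : rel T).
Hypotheses (e_sym : symmetric e) (e_irr : irreflexive e).

Definition degree_in (X : {set T}) (x : T) : nat := #|[set y in X | e x y]|.

Definition degree_seq_in (X : {set T}) : seq nat :=
  sort geq [seq degree_in X x | x <- enum X].

Lemma degree_inE X x : degree_in X x = \sum_(y in X) e x y.
Proof.
rewrite /degree_in -sum1_card big_mkcond [RHS]big_mkcond /=.
by apply: eq_bigr => y _; rewrite inE; case: (y \in X); case: (e x y).
Qed.

Lemma excess_degree_seq_in X t :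
  excess (degree_seq_in X) t = \sum_(x in X) (degree_in X x - t).
Proof.
rewrite (perm_excess t (permEl (perm_sort _ _))) /excess big_map.
by rewrite big_enum.
Qed.

Lemma sorted_degree_seq_in X : sorted geq (degree_seq_in X).
Proof. exact: sort_sorted geq_total _. Qed.

Lemma size_degree_seq_in X : size (degree_seq_in X) = #|X|.
Proof. by rewrite size_sort size_map -cardE. Qed.

(** Both claims are proved together: the side condition for the graph without [v] passes by
    monotonicity to the Havel-Hakimi step. *)
Lemma independent_of_residue n (X : {set T}) : #|X| = n ->
  laying_off_ok n (degree_seq_in X) /\
  exists2 S : {set T}, independent e S &
    havel_hakimi_zeros n (degree_seq_in X) <= #|S|.
Proof.
elim: n X => [|n IHn] X cardX.
  split=> //; exists set0; first by apply/forall_inP => x; rewrite inE.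
  by rewrite cards0 /= -[X in _ <= X]cardX -size_degree_seq_in; case: ifP.
have d_sorted := sorted_degree_seq_in X.
have sz_d := size_degree_seq_in X; rewrite cardX in sz_d.
have excess_d := excess_degree_seq_in X.
case def_d: (degree_seq_in X) d_sorted sz_d excess_d => [|D r] //
  d_sorted [sz_r] excess_d.
have [D0|D_gt0] := posnP D.
  split; first exact: laying_off_ok0.
  exists X; last by rewrite havel_hakimi_zeros0 //= sz_r cardX.
  apply/forall_inP => x xX; apply/forall_inP => y yX; apply/negP => exy.
  have /esym/eqP := excess_d 0; rewrite excess_ge_head //= ?D0 // sum_nat_eq0.
  move/forall_inP/(_ x xX); rewrite subn0 degree_inE sum_nat_eq0.
  by move/forall_inP/(_ y yX); rewrite exy.
have /mapP[v] : D \in [seq degree_in X x | x <- enum X].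
  by rewrite -(mem_sort geq) -/(degree_seq_in X) def_d mem_head.
rewrite mem_enum => vX def_D.
pose X' := X :\ v.
have cardX' : #|X'| = n by have := cardsD1 v X; rewrite vX cardX; case.
have deg_X x : degree_in X x = degree_in X' x + e x v.
  by rewrite !degree_inE (big_setD1 v) //= addnC.
have D_sum : D = \sum_(x in X') e x v.
  rewrite def_D deg_X e_irr addn0 degree_inE.
  by apply: eq_bigr => x _; rewrite e_sym.
have excess_r t : excess r t = \sum_(x in X') (degree_in X' x + e x v - t).
  have := excess_d t; rewrite excess_cons (big_setD1 v) //= -def_D => /addnI ->.
  by apply: eq_bigr => x _; rewrite deg_X.
have le_S t : excess r t.+1 <= excess (degree_seq_in X') t.
  by rewrite excess_r excess_degree_seq_in; apply: leq_sum => x _; lia.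
have le_D t : excess r t <= excess (degree_seq_in X') t + D.
  rewrite excess_r excess_degree_seq_in D_sum -big_split /=.
  by apply: leq_sum => x _; lia.
have E0 : excess r 0 = excess (degree_seq_in X') 0 + D.
  rewrite excess_r excess_degree_seq_in D_sum -big_split /=.
  by apply: eq_bigr => x _; lia.
have r_pos : D <= count (ltn 0) r.
  by have := excessS r 0; have := le_S 0; lia.
(* Deleting [v] lowers the degrees of its [D] neighbours, while the step lowers the [D] largest
   terms, which makes every excess as small as possible. *)
have maj : majorizes (degree_seq_in X') (havel_hakimi_step (D :: r)).
  split=> [|t]; rewrite excess_step //; first by have := le_S 0; lia.
  by have := le_S t; have := le_D t; lia.
have [ok' [S indepS le_S']] := IHn X' cardX'.
have [| | | |ok_r le_z] := (residue_le_majorizes_near n).1 _ _ _ _ _ _ maj ok'.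
- exact: sorted_degree_seq_in.
- exact: sorted_step.
- by rewrite size_degree_seq_in.
- by rewrite size_step.
split; first by rewrite /= r_pos ok_r orbT.
exists S => //; rewrite /= (gtn_eqF D_gt0) /=.
exact: leq_trans le_z le_S'.
Qed.

End InducedDegrees.

(** * Edges, matchings and the annihilation number *)

Section EdgeCounting.
Variables (T : finType) (e : rel T).
Hypotheses (e_sym : symmetric e) (e_irr : irreflexive e).
Implicit Types (A X Y S : {set T}) (M N : {set {set T}}).

Lemma edge_neq x y : e x y -> x != y.
Proof. by apply: contraTneq => ->; rewrite e_irr. Qed.

Lemma edgesP (E : {set T}) :
  reflect (exists x y, e x y /\ E = [set x; y]) (E \in edges e).
Proof.
apply: (iffP imsetP) => [[[x y]]|[x [y [exy ->]]]]; last first.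
  by exists (x, y); rewrite ?inE.
by rewrite inE /= => exy ->; exists x, y.
Qed.

Lemma in_edges x y : ([set x; y] \in edges e) = e x y.
Proof.
apply/edgesP/idP => [[u [v [euv eq_xy]]]|exy]; last by exists x, y.
have /set2P xuv : x \in [set u; v] by rewrite -eq_xy set21.
have /set2P yuv : y \in [set u; v] by rewrite -eq_xy set22.
have /set2P uxy : u \in [set x; y] by rewrite eq_xy set21.
have /set2P vxy : v \in [set x; y] by rewrite eq_xy set22.
have neq_uv := edge_neq euv.
case: xuv => xE; case: yuv => yE; subst x y; rewrite ?(e_sym v u) //.
  by case: vxy neq_uv => ->; rewrite eqxx.
by case: uxy neq_uv => ->; rewrite eqxx.
Qed.

Lemma card_edge E : E \in edges e -> #|E| = 2.
Proof. by case/edgesP => x [y [exy ->]]; rewrite cards2 edge_neq. Qed.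

Lemma degree_edges x : degree e x = #|[set E in edges e | x \in E]|.
Proof.
rewrite /degree -(card_in_imset (f := fun y => [set x; y])); last first.
  move=> y z; rewrite !inE => exy exz /setP/(_ y).
  by rewrite !inE eqxx orbT eq_sym (negPf (edge_neq exy)) => /esym/eqP.
apply: eq_card => E; rewrite inE; apply/imsetP/andP => [[y]|[]].
  by rewrite inE => exy ->; rewrite in_edges set21.
case/edgesP => u [v [euv ->]]; rewrite in_set2 => /orP[]/eqP->.
  by exists v; rewrite ?inE.
by exists u; rewrite ?inE 1?e_sym // setUC.
Qed.

Lemma sum_degree A :
  \sum_(x in A) degree e x = \sum_(E in edges e) #|E :&: A|.
Proof.
under eq_bigr do rewrite degree_edges -sum1_card.
under [RHS]eq_bigr do rewrite -sum1_card.
rewrite (exchange_big_dep (mem (edges e))) /=; last first.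
  by move=> x E _; rewrite inE => /andP[].
apply: eq_bigr => E E_edge; apply: eq_bigl => x.
by rewrite !inE E_edge andbC.
Qed.

Definition edges_in X : {set {set T}} := [set E in edges e | E \subset X].

Lemma edges_in_sub X : edges_in X \subset edges e.
Proof. by apply/subsetP => E; rewrite inE => /andP[]. Qed.

Lemma in_edges_in X x y :
  ([set x; y] \in edges_in X) = [&& e x y, x \in X & y \in X].
Proof. by rewrite inE in_edges subUset !sub1set. Qed.

Lemma edges_in_setT : edges_in setT = edges e.
Proof. by apply/setP => E; rewrite inE subsetT andbT. Qed.

Lemma edges_in_sub2 X Y : X \subset Y -> edges_in X \subset edges_in Y.
Proof.
move=> sXY; apply/subsetP => E; rewrite !inE => /andP[-> sEX].
exact: subset_trans sEX sXY.
Qed.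

(** An edge meets [A] in one vertex, plus one if it lies inside [A], minus one if it avoids [A]. *)
Lemma sum_degree_edges_in A :
  \sum_(x in A) degree e x + #|edges_in (~: A)| = num_edges e + #|edges_in A|.
Proof.
have card_edges_in X : #|edges_in X| = \sum_(E in edges e) (E \subset X).
  rewrite -sum1_card big_mkcond [RHS]big_mkcond; apply: eq_bigr => E _.
  by rewrite inE; case: (E \in edges e); case: (E \subset X).
rewrite sum_degree !card_edges_in /num_edges -sum1_card -!big_split /=.
apply: eq_bigr => _ /edgesP[x [y [exy ->]]]; rewrite setIUl.
rewrite cardsU -setIIl.
have /eqP -> : [set x] :&: [set y] == set0.
  by rewrite setI_eq0 disjoints1 inE edge_neq.
rewrite set0I cards0 subn0 !subUset !sub1set !inE.
have card1I z : #|[set z] :&: A| = (z \in A).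
  case: (boolP (z \in A)) => zA; last first.
    by apply/eqP; rewrite cards_eq0 setI_eq0 disjoints1.
  by rewrite (setIidPl _) ?sub1set // cards1.
by rewrite !card1I; case: (x \in A); case: (y \in A).
Qed.

Lemma sum_degree_setT : \sum_x degree e x = (num_edges e).*2.
Proof.
have := sum_degree_edges_in setT.
rewrite setCT edges_in_setT -/(num_edges e) addnn => <-.
rewrite [edges_in set0](_ : _ = set0) ?cards0 ?addn0.
  by apply: eq_bigl => x; rewrite inE.
apply/setP => E; rewrite !inE subset0; apply/negP => /andP[/card_edge cE /eqP E0].
by rewrite E0 cards0 in cE.
Qed.

Lemma edges_in_independent S : independent e S -> edges_in S = set0.
Proof.
move=> indS; apply/setP => E; rewrite in_set0; apply/negP.
rewrite inE => /andP[/edgesP[x [y [exy ->]]]].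
rewrite subUset !sub1set => /andP[xS yS].
by have /forall_inP/(_ x xS)/forall_inP/(_ y yS)/negP := indS.
Qed.

Lemma matching_setU X Y M N : [disjoint X & Y] ->
  M \subset edges_in X -> matching e M ->
  N \subset edges_in Y -> matching e N ->
  matching e (M :|: N) /\ #|M :|: N| = #|M| + #|N|.
Proof.
move=> disXY sMX /andP[sM tM] sNY /andP[sN tN].
have cover_sub Z (P : {set {set T}}) : P \subset edges_in Z -> cover P \subset Z.
  move=> sPZ; apply/bigcupsP => E /(subsetP sPZ).
  by rewrite inE => /andP[].
have dis : [disjoint cover M & cover N].
  by apply: disjointW disXY; apply: cover_sub.
split; first by rewrite /matching subUset sM sN trivIsetU.
rewrite cardsU [M :&: N](_ : _ = set0) ?cards0 ?subn0 //.
apply/setP => E; rewrite in_set0; apply/negP => /setIP[EM EN].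
have := card_edge (subsetP sM _ EM).
suff -> : E = set0 by rewrite cards0.
apply/eqP; rewrite -subset0 -(eqP (_ : cover M :&: cover N == set0)) ?setI_eq0 //.
by rewrite subsetI; apply/andP; split; apply: (bigcup_sup E).
Qed.

Lemma matching1 x y : e x y -> matching e [set [set x; y]].
Proof. by move=> exy; rewrite /matching sub1set in_edges exy trivIset1. Qed.

Lemma card_cover_matching M : matching e M -> #|cover M| = #|M|.*2.
Proof.
case/andP=> /subsetP sM /eqP <-; rewrite -muln2 -sum_nat_const.
by apply: eq_bigr => E /sM/card_edge.
Qed.

Lemma maximal_matching X : exists M,
  [/\ matching e M, M \subset edges_in X, cover M \subset X
    & independent e (X :\: cover M)].
Proof.
pose P (M : {set {set T}}) := matching e M && (M \subset edges_in X).
have P0 : P set0.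
  by rewrite /P /matching !sub0set /trivIset /cover !big_set0 cards0 eqxx.
case: (arg_maxnP (fun M => #|M|) P0) => M /andP[mM sMX] M_max.
exists M; split=> //.
  by apply/bigcupsP => E /(subsetP sMX); rewrite inE => /andP[].
apply/forall_inP => x /setDP[xX xM]; apply/forall_inP => y /setDP[yX yM].
apply/negP => exy; pose Z := cover M.
have sMZ : M \subset edges_in Z.
  apply/subsetP => E EM; rewrite inE.
  rewrite (subsetP (subset_trans sMX (edges_in_sub _))) //=.
  exact: (bigcup_sup E).
have sxy : [set [set x; y]] \subset edges_in [set x; y].
  by rewrite sub1set in_edges_in exy set21 set22.
have dis : [disjoint Z & [set x; y]].
  rewrite disjoint_sym disjoints_subset subUset !sub1set !inE.
  by rewrite xM yM.
have [mU cU] := matching_setU dis sMZ mM sxy (matching1 exy).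
have /M_max : P (M :|: [set [set x; y]]).
  by rewrite /P mU subUset sMX sub1set in_edges_in exy xX yX.
by rewrite /= cU cards1 addn1 ltnn.
Qed.

Lemma matching_le M : matching e M -> #|M| <= matching_number e.
Proof. exact: leq_bigmax_cond. Qed.

Lemma independent_le S : independent e S -> #|S| <= independence_number e.
Proof. exact: leq_bigmax_cond. Qed.

(* Deleting a vertex with at least two edges, or a leaf together with its
   neighbour, does not increase [2 alpha + mu + m - 2 n]. *)
Lemma independent_matching_edges X : exists S M,
  [/\ independent e S, S \subset X, matching e M, M \subset edges_in X
    & #|X|.*2 <= #|S|.*2 + #|M| + #|edges_in X|].
Proof.
have [n] := ubnP #|X|; elim: n X => // n IHn X /ltnSE le_Xn.
have [indX|] := boolP (independent e X).
  exists X, set0; split; rewrite ?sub0set //; last by rewrite -addnA leq_addr.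
  by rewrite /matching sub0set /trivIset /cover !big_set0 cards0 eqxx.
rewrite negb_forall_in => /exists_inP[x xX].
rewrite negb_forall_in => /exists_inP[y yX]; rewrite negbK => exy.
have [/exists_inP[z zX /andP[ne_zy exz]]|x_leaf] :=
  boolP [exists z in X, (z != y) && e x z].
  have sX'X := subD1set X x.
  have cX' : #|X| = #|X :\ x|.+1 by rewrite (cardsD1 x) xX.
  have [|S [M [indS sS mM sM le_M]]] := IHn (X :\ x); first by rewrite -cX'.
  exists S, M; split=> //; first exact: subset_trans sS sX'X.
    exact: subset_trans sM (edges_in_sub2 sX'X).
  (* The two edges lost at [x] pay for its share in [2 #|X|]. *)
  suff : #|edges_in (X :\ x)| + 2 <= #|edges_in X|.
    move: le_M; rewrite cX'; clear.
    by move: #|X :\ x| #|S| #|M| #|edges_in _| #|edges_in X| => *; lia.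
  pose F := [set [set x; y]; [set x; z]].
  have <- : #|F| = 2.
    rewrite cards2; suff -> : [set x; y] != [set x; z] by [].
    apply/eqP => /setP/(_ z); rewrite !inE eqxx orbT (negPf ne_zy) orbF.
    by rewrite eq_sym (negPf (edge_neq exz)).
  have disF : [disjoint edges_in (X :\ x) & F].
    rewrite disjoint_sym disjoints_subset subUset !sub1set !in_setC !in_edges_in.
    by rewrite !in_setD1 eqxx !andbF.
  have <- : #|edges_in (X :\ x) :|: F| = #|edges_in (X :\ x)| + #|F|.
    by rewrite cardsU (disjoint_setI0 disF) cards0 subn0.
  apply: subset_leq_card; rewrite subUset edges_in_sub2 //.
  by rewrite subUset !sub1set !in_edges_in exy exz xX yX zX.
(* Now [y] is the only neighbour of [x] in [X]. Deleting both lowers [2 #|X|] by 4: [x] joining [S]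
   repays 2, the edge [xy] repays 1 in the matching and 1 in the edge count. *)
pose X' := X :\: [set x; y].
have sX'X : X' \subset X := subsetDl _ _.
have sxyX : [set x; y] \subset X by rewrite subUset !sub1set xX.
have cX' : #|X| = #|X'| + 2.
  have := cardsDS sxyX; have := subset_leq_card sxyX.
  by rewrite -/X' cards2 edge_neq //; lia.
have disX' : [disjoint X' & [set x; y]].
  rewrite disjoint_sym disjoints_subset; apply/subsetP => z zxy.
  by rewrite !inE -in_set2 zxy.
have [|S [M [indS sS mM sM le_M]]] := IHn X'; first lia.
have sxy : [set [set x; y]] \subset edges_in [set x; y].
  by rewrite sub1set in_edges_in exy set21 set22.
have [mU cU] := matching_setU disX' sM mM sxy (matching1 exy).
have x_isol z : z \in S -> e x z = false.
  move=> /(subsetP sS) /setDP[zX]; rewrite in_set2 negb_or => /andP[_ ne_zy].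
  by apply: contraNF x_leaf => exz; apply/exists_inP; exists z; rewrite ?ne_zy.
have xS : x \notin S.
  by apply/negP => /(subsetP sS); rewrite !inE eqxx.
exists (x |: S), (M :|: [set [set x; y]]); split=> //.
- apply/forall_inP => u /setU1P[->|uS]; apply/forall_inP => v /setU1P[->|vS].
  + by rewrite e_irr.
  + by rewrite x_isol.
  + by rewrite e_sym x_isol.
  + by have /forall_inP/(_ u uS)/forall_inP/(_ v vS) := indS.
- by rewrite subUset sub1set xX (subset_trans sS).
- rewrite subUset (subset_trans sM (edges_in_sub2 _)) ?sub1set //.
  by rewrite in_edges_in exy xX.
suff : #|edges_in X'| + 1 <= #|edges_in X|.
  move: le_M; rewrite cX' cU cardsU1 xS cards1; clear.
  by move: #|X'| #|S| #|M| #|edges_in X'| #|edges_in X| => *; lia.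
rewrite addn1; apply: proper_card; apply/properP.
split; first exact: edges_in_sub2.
exists [set x; y]; first by rewrite in_edges_in exy xX.
by rewrite in_edges_in !inE eqxx !andbF.
Qed.

End EdgeCounting.

(** * Sorted degrees and the annihilation number *)

Lemma sumn_take_subseq s t : sorted leq s -> subseq t s ->
  sumn (take (size t) s) <= sumn t.
Proof.
elim: s t => [|x s IHs] [|y t] //= s_sorted; rewrite ?take0 //.
have s_sorted' := path_sorted s_sorted.
case: eqP => [<- sub_ts|_ sub_ts]; first by rewrite leq_add2l IHs.
apply: leq_trans (IHs _ s_sorted' sub_ts) => /=.
have lt_ts : size t < size s by exact: size_subseq sub_ts.
rewrite (take_nth 0) // sumn_rcons addnC leq_add2l.
by have /allP-> := order_path_min leq_trans s_sorted; rewrite ?mem_nth.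
Qed.

Lemma sum_nth_take s k : k <= size s ->
  \sum_(i < k) nth 0 s i = sumn (take k s).
Proof.
move=> le_ks; rewrite sumnE (big_nth 0) size_takel // big_mkord.
by apply: eq_bigr => i _; rewrite nth_take.
Qed.

Lemma bin2_double n : 'C(n, 2) * 2 + n = n * n.
Proof. by elim: n => // n IHn; rewrite binS bin1; lia. Qed.

Section AnnihilationNumber.
Variables (T : finType) (e : rel T).
Hypotheses (e_sym : symmetric e) (e_irr : irreflexive e).

(** Realizes segments of [degree_seq] by actual sets of vertices. *)
Definition vertices_by_degree : seq T := sort (relpre (degree e) leq) (enum T).

Lemma degree_seqE : degree_seq e = [seq degree e x | x <- vertices_by_degree].
Proof. exact: sort_map. Qed.

Lemma size_degree_seq : size (degree_seq e) = #|T|.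
Proof. by rewrite size_sort size_map -cardE. Qed.

Lemma sorted_degree_seq : sorted leq (degree_seq e).
Proof. exact: sort_sorted leq_total _. Qed.

Lemma sumn_degree_seq : sumn (degree_seq e) = (num_edges e).*2.
Proof.
rewrite -sum_degree_setT // sumnE (perm_big _ (permEl (perm_sort _ _))) big_map.
by rewrite big_enum.
Qed.

Lemma uniq_vertices_by_degree : uniq vertices_by_degree.
Proof. by rewrite sort_uniq; exact: enum_uniq. Qed.

Lemma sumn_degree_seq_le (S : {set T}) :
  sumn (take #|S| (degree_seq e)) <= \sum_(x in S) degree e x.
Proof.
pose vS := filter (mem S) vertices_by_degree.
have perm_vS : perm_eq vS (enum S).
  apply: uniq_perm => [||x]; first exact/filter_uniq/uniq_vertices_by_degree.
    exact: enum_uniq.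
  by rewrite mem_filter mem_sort !mem_enum andbT.
have <- : sumn [seq degree e x | x <- vS] = \sum_(x in S) degree e x.
  by rewrite sumnE big_map (perm_big _ perm_vS) big_enum.
have <- : size [seq degree e x | x <- vS] = #|S|.
  by rewrite size_map (perm_size perm_vS) -cardE.
apply: sumn_take_subseq sorted_degree_seq _.
by rewrite degree_seqE map_subseq // filter_subseq.
Qed.

Lemma le_annihilation_number k : k <= #|T| ->
  sumn (take k (degree_seq e)) <= num_edges e -> k <= annihilation_number e.
Proof.
move=> le_kn le_m; have lt_kn : k < #|T|.+1 by [].
apply: (leq_bigmax_cond (Ordinal lt_kn)).
by rewrite sum_nth_take ?size_degree_seq.
Qed.

Lemma annihilation_numberP : annihilation_number e <= #|T| /\
  sumn (take (annihilation_number e) (degree_seq e)) <= num_edges e.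
Proof.
pose P (k : 'I_#|T|.+1) := \sum_(i < k) nth 0 (degree_seq e) i <= num_edges e.
have P0 : 0 < #|[pred k | P k]|.
  by apply/card_gt0P; exists ord0; rewrite inE /P big_ord0.
have [k Pk def_a] := eq_bigmax_cond (@nat_of_ord _) P0.
rewrite /annihilation_number [\big[_/_]_(_ < _ | _) _]def_a.
have le_kn : k <= #|T| by rewrite -ltnS.
by split=> //; rewrite -sum_nth_take ?size_degree_seq.
Qed.

(** Each edge meets an independent set at most once, so the degrees in the set sum to at most the
    number of edges; the smallest degrees sum to no more. *)
Lemma independence_le_annihilation :
  independence_number e <= annihilation_number e.
Proof.
apply/bigmax_leqP => S indS; apply: le_annihilation_number; first exact: max_card.
apply: leq_trans (sumn_degree_seq_le S) _.
have := sum_degree_edges_in e_sym e_irr S.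
by rewrite (edges_in_independent indS) cards0 addn0 => <-; exact: leq_addr.
Qed.

(* [K] consists of the vertices beyond the annihilation number, whose degrees
   sum to at least half of the total. *)
Lemma annihilation_complement : exists K : {set T},
  [/\ #|K| + annihilation_number e = #|T|
    & #|edges_in e (~: K)| <= #|edges_in e K| ].
Proof.
have [le_an le_m] := annihilation_numberP.
set a := annihilation_number e in le_an le_m *.
pose vK := drop a vertices_by_degree; pose K := [set x in vK].
have uniq_vK : uniq vK by exact/drop_uniq/uniq_vertices_by_degree.
have perm_vK : perm_eq (enum K) vK.
  by apply: uniq_perm => // [|x]; rewrite ?enum_uniq // mem_enum inE.
exists K; split.
  rewrite cardE (perm_size perm_vK) size_drop size_sort -cardE.
  by rewrite subnK.
have := sum_degree_edges_in e_sym e_irr K.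
have -> : \sum_(x in K) degree e x = sumn (drop a (degree_seq e)).
  rewrite degree_seqE -map_drop sumnE big_map -(perm_big _ perm_vK) /=.
  by rewrite big_enum.
have := sumn_degree_seq; rewrite -{1}(cat_take_drop a (degree_seq e)) sumn_cat.
by lia.
Qed.

Lemma annihilation_lt : 0 < num_edges e -> annihilation_number e < #|T|.
Proof.
move=> e_edge; have [le_an le_m] := annihilation_numberP.
rewrite ltn_neqAle le_an andbT; apply: contraTneq le_m => ->.
by rewrite -size_degree_seq take_size sumn_degree_seq; lia.
Qed.

(** The vertices missed by a maximal matching are independent. This also makes the truncated
    difference [alpha + 2 mu - n] exact. *)
Lemma order_le_independence_matching :
  #|T| <= independence_number e + (matching_number e).*2.
Proof.
have [M [mM _ _ indU]] := maximal_matching e_sym e_irr setT.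
have := independent_le indU; have := matching_le mM.
have := card_cover_matching e_irr mM; rewrite setTD; have := cardsC (cover M).
by have := max_card (mem (cover M)); lia.
Qed.

Lemma matching_number_bound : 0 < num_edges e ->
  6 * matching_number e <=
  (independence_number e + (matching_number e).*2 - #|T|
   + (#|T| - annihilation_number e) + 1) ^ 2.
Proof.
move=> e_edge; have lt_an := annihilation_lt e_edge.
set s := _ - #|T|; set k := #|T| - _; rewrite /=.
have [K [card_K le_HK]] := annihilation_complement.
have [M [mM sM sMK indU]] := maximal_matching e_sym e_irr K.
have [S [N [indS sS mN sN le_N]]] :=
  independent_matching_edges e_sym e_irr (~: K).
have disK : [disjoint K & ~: K] by rewrite -setI_eq0 setICr.
have [mU cU] := matching_setU e_irr disK sM mM sN mN.
have := matching_le mU; rewrite cU => le_mu.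
have := independent_le indS => le_alpha.
have le_n := order_le_independence_matching.
pose U := K :\: cover M.
have card_U : #|U| + #|M|.*2 = #|K|.
  rewrite -(card_cover_matching e_irr mM) /U cardsDS // subnK //.
  exact: subset_leq_card.
have le_edges : #|edges_in e K| + 'C(#|U|, 2) <= 'C(#|K|, 2).
  rewrite -!cards_draws.
  set P := [set A : {set T} | A \subset U & #|A| == 2].
  have dis : [disjoint edges_in e K & P].
    rewrite disjoints_subset; apply/subsetP => E; rewrite !inE => /andP[EE _].
    apply/negP => /andP[sEU _]; have := edges_in_independent indU.
    by move/setP/(_ E); rewrite !inE EE sEU.
  have <- : #|edges_in e K :|: P| = #|edges_in e K| + #|P|.
    by rewrite cardsU (disjoint_setI0 dis) cards0 subn0.
  apply: subset_leq_card; rewrite subUset; apply/andP; split; apply/subsetP => E.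
    by rewrite !inE => /andP[EE ->]; rewrite (card_edge e_irr EE).
  by rewrite !inE => /andP[sEU ->]; rewrite (subset_trans sEU) ?subsetDl.
have cardCK := cardsC K.
have := bin2_double #|K|; have := bin2_double #|U|.
have eq_k : k = #|K| by rewrite /k -card_K addnK.
have eq_s : s + #|T| = independence_number e + (matching_number e).*2.
  by rewrite /s subnK.
(* With [u = #|U|], the right side exceeds the left by at least [(u - 1)^2 + s^2 + 2 s (k - 1)], and
   [k] is positive because there is an edge. *)
rewrite -mulnn eq_k; have := card_U; rewrite -/U => <-.
move: le_edges; rewrite -card_U; nia.
Qed.

End AnnihilationNumber.

(** * Real-valued parameters *)

From mathcomp Require Import ring lra.
Local Open Scope ring_scope.

(** * The Caro-Wei sum along Havel-Hakimi steps *)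

Lemma all_take_pos s k : sorted geq s -> (k <= count (ltn 0) s)%N ->
  all (ltn 0) (take k s).
Proof.
elim: s k => [|x s IHs] [|k] //= s_sorted.
have [x0|x_gt0] := posnP x; last first.
  by rewrite ltnS; apply/IHs/(path_sorted s_sorted).
have := excessS s 0; rewrite (excess_tail_ge s_sorted) ?x0 //; lia.
Qed.

(** A step loses [1 / (a + 1)] with the head, while each of the [a] lowered terms [x] gains
    [1 / x - 1 / (x + 1)], which is at least [1 / (a (a + 1))] as [x <= a]. *)
Lemma caro_wei_le_zeros (R : realFieldType) n s : sorted geq s -> size s = n ->
  laying_off_ok n s ->
  \sum_(x <- s) 1 / (x%:R + 1) <= (havel_hakimi_zeros n s)%:R :> R.
Proof.
elim: n s => [|n IHn] s s_sorted sz_s ok_s.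
  by rewrite (size0nil sz_s) big_nil ler0n.
case: s => // a r in s_sorted sz_s ok_s *; case: sz_s => sz_r.
have [a0|a_gt0] := posnP a.
  rewrite havel_hakimi_zeros0 // -sum1_size natr_sum.
  apply: ler_sum => x _; rewrite ler_pdivrMr ?mul1r ?lerDr ?ler0n //.
  by rewrite ltr_wpDl ?ler0n.
have [r_pos ok_r] := laying_off_ok_step s_sorted ok_s.
have r_sorted := path_sorted s_sorted.
rewrite /= (gtn_eqF a_gt0) /=.
apply: le_trans (IHn _ (sorted_step _) _ ok_r); last by rewrite size_step.
rewrite big_cons step_cons (perm_big _ (permEl (perm_sort _ _))).
rewrite big_cat big_map /=.
rewrite -{1}(cat_take_drop a r) big_cat addrA lerD2r /=.
have sz_t : size (take a r) = a.
  by rewrite size_takel // (leq_trans r_pos) // count_size.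
have aR_gt0 : 0 < a%:R :> R by rewrite ltr0n.
(* The loss is spread evenly over the [a] lowered terms, to be compared term by term. *)
have -> : 1 / (a%:R + 1) = \sum_(x <- take a r) 1 / (a%:R * (a%:R + 1)) :> R.
  rewrite big_const_seq count_predT sz_t iter_addr_0 -mulr_natl.
  by field; rewrite !gt_eqF //; lra.
rewrite -big_split /= big_seq [leRHS]big_seq; apply: ler_sum => x x_t.
have := allP (all_take_pos r_sorted r_pos) x x_t.
have : (x <= a)%N by exact: sorted_geq_le s_sorted _ (mem_take x_t).
case: x {x_t} => // x lt_xa _ /=; rewrite -natr1 in lt_xa *.
have {lt_xa} : x%:R + 1 <= a%:R :> R by rewrite natr1 ler_nat.
have : 0 <= x%:R :> R by rewrite ler0n.
move: (x%:R) (a%:R) aR_gt0 => y b b_gt0 y_ge0 le_yb.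
have -> : 1 / (y + 1) = 1 / (y + 1 + 1) + 1 / ((y + 1) * (y + 1 + 1)).
  by field; rewrite !gt_eqF //; lra.
rewrite addrC lerD2l !div1r lef_pV2 ?posrE ?mulr_gt0 //; try lra.
by apply: ler_pM; lra.
Qed.

(** * The inequalities for graphs *)

Section RealBounds.
Variables (R : realType) (T : finType) (e : rel T).
Hypotheses (e_sym : symmetric e) (e_irr : irreflexive e).

Lemma degree_in_setT : degree_in e setT =1 degree e.
Proof. by move=> x; apply: eq_card => y; rewrite !inE. Qed.

Lemma residueE : residue e = havel_hakimi_zeros #|T| (degree_seq_in e setT).
Proof.
rewrite /residue /degree_seq_in enum_setT -enumT.
congr (havel_hakimi_zeros _ (sort _ _)).
exact/esym/eq_map/degree_in_setT.
Qed.

Lemma residue_le_independence : (residue e <= independence_number e)%N.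
Proof.
have [_ [S indS le_S]] := independent_of_residue e_sym e_irr (cardsT T).
by rewrite residueE (leq_trans le_S) ?independent_le.
Qed.

Lemma caro_weiE : caro_wei R e = \sum_(x <- degree_seq e) 1 / (x%:R + 1).
Proof. by rewrite (big_nth 0%N) size_degree_seq. Qed.

Lemma caro_wei_le_residue : caro_wei R e <= (residue e)%:R.
Proof.
have [ok _] := independent_of_residue e_sym e_irr (cardsT T).
have sz := size_degree_seq_in e setT; rewrite cardsT in sz.
have := caro_wei_le_zeros R (sorted_degree_seq_in e setT) sz ok.
rewrite residueE caro_weiE; apply: le_trans; rewrite le_eqVlt; apply/orP; left.
apply/eqP/perm_big; rewrite perm_sort perm_sym perm_sort enum_setT -enumT.
by rewrite (eq_map degree_in_setT).
Qed.

Lemma max_degree_gt0 : (0 < num_edges e)%N -> (0 < max_degree e)%N.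
Proof.
rewrite /num_edges card_gt0 => /set0Pn[_ /edgesP[x [y [exy _]]]].
apply: leq_trans (leq_bigmax x); rewrite /degree card_gt0.
by apply/set0Pn; exists y; rewrite inE.
Qed.

(** Against the sums in [sigma], each of the first [a] degrees [d] leaves [1 - d / (2 D)] and each
    later one leaves [1 / 2]. The first summand of [sigma] cancels all of this except [a]. *)
Lemma annihilation_numberE : (0 < num_edges e)%N ->
  (annihilation_number e)%:R =
    ((max_degree e)%:R + 1) / 2 * caro_wei R e - sigma R e.
Proof.
move=> /max_degree_gt0; have [le_an _] := annihilation_numberP e.
rewrite /caro_wei /sigma /S_H (big_cat_nat (n := annihilation_number e)) //=.
set a := annihilation_number e in le_an *; set D := max_degree e => D_gt0.
pose d i : R := (nth 0%N (degree_seq e) i)%:R.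
have D_neq0 : D%:R != 0 :> R by rewrite pnatr_eq0 -lt0n.
have d1_neq0 i : d i + 1 != 0 by rewrite gt_eqF // ltr_wpDl ?ler0n.
have low : (D%:R + 1) / 2 * (\sum_(0 <= i < a) 1 / (d i + 1))
    - \sum_(0 <= i < a) (D%:R - d i) * (D%:R - d i - 1) / (2 * D%:R * (d i + 1))
    = a%:R - (\sum_(0 <= i < a) d i) / (2 * D%:R).
  have -> : a%:R = \sum_(0 <= i < a) 1 :> R by rewrite sumr_const_nat subn0.
  rewrite mulr_sumr mulr_suml -!sumrB.
  apply: eq_bigr => i _; move: (d i) (d1_neq0 i) => x x1.
  by field; rewrite x1 D_neq0.
have high : (D%:R + 1) / 2 * (\sum_(a <= i < #|T|) 1 / (d i + 1))
    - \sum_(a <= i < #|T|) (D%:R - d i) / (2 * (d i + 1))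
    = (#|T|%:R - a%:R) / 2.
  rewrite mulr_sumr -sumrB -natrB // mulr_natl -sumr_const_nat.
  apply: eq_bigr => i _; move: (d i) (d1_neq0 i) => x x1.
  by field; rewrite x1.
have -> : (D%:R * (#|T|%:R - a%:R) - \sum_(0 <= i < a) d i) / (2 * D%:R)
    = (#|T|%:R - a%:R) / 2 - (\sum_(0 <= i < a) d i) / (2 * D%:R) :> R.
  by field; rewrite D_neq0.
move: low high; rewrite mulrDr /d; lra.
Qed.

Lemma annihilation_Gamma_le : (0 < num_edges e)%N ->
  (annihilation_number e)%:R - (Gamma R (matching_number e))%:~R
    <= (independence_number e)%:R :> R.
Proof.
move=> e_edge.
have mu_gt0 : (0 < matching_number e)%N.
  have := e_edge; rewrite {1}/num_edges card_gt0.
  move=> /set0Pn[_ /edgesP[x [y [exy _]]]].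
  by rewrite -(cards1 [set x; y]) matching_le ?matching1.
have le_n := order_le_independence_matching e_sym e_irr.
have lt_an := annihilation_lt e_sym e_irr e_edge.
have := matching_number_bound e_sym e_irr e_edge.
rewrite /Gamma (gtn_eqF mu_gt0).
set mu := matching_number e in mu_gt0 le_n *.
set al := independence_number e in le_n *.
set a := annihilation_number e in lt_an *.
(* By [le_n] and [lt_an] no subtraction truncates, so [m] is [al + 2 mu - a + 1]; bounding the
   ceiling of the root by [m] is the claim. *)
set m := (al + mu.*2 - #|T| + (#|T| - a) + 1)%N => le_mu.
have : Num.ceil (Num.sqrt (6 * mu%:R : R)) <= m%:Z.
  rewrite ceil_le_int -(@ger0_norm _ m%:~R) ?ler0z //.
  rewrite -sqrtr_sqr ler_wsqrtr //.
  by rewrite -natrM pmulrn -natrX ler_nat.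
set c := Num.ceil _ => le_cm.
rewrite !pmulrn -intrB ler_int.
by rewrite /m in le_cm; lia.
Qed.

End RealBounds.

Theorem corollary7p5 (R : realType) (T : finType) (e : rel T)
    (e_sym : symmetric e) (e_irr : irreflexive e)
    (e_edge : (1 <= num_edges e)%N) :
  let alpha := (independence_number e)%:R : R in
  let a := (annihilation_number e)%:R : R in
  let res := (residue e)%:R : R in
  let W := caro_wei R e in
  let Delta := (max_degree e)%:R : R in
  let sigma := sigma R e in
  (Num.max (Num.max res W) (a - (Gamma R (matching_number e))%:~R) <= alpha
   /\ alpha <= a) /\
  (a = (Delta + 1) / 2 * W - sigma /\
   (Delta + 1) / 2 * W - sigma <= (Delta + 1) / 2 * res - sigma).
Proof.
have le_Wres := caro_wei_le_residue R e_sym e_irr.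
have le_res : (residue e)%:R <= (independence_number e)%:R :> R.
  by rewrite ler_nat residue_le_independence.
move=> alpha a res W Delta sigma.
split; split.
- rewrite !ge_max le_res (le_trans le_Wres le_res) /=.
  exact: annihilation_Gamma_le.
- by rewrite ler_nat independence_le_annihilation.
- exact: annihilation_numberE.
by rewrite lerD2r ler_wpM2l // divr_ge0 // addr_ge0.
Qed.
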